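(* Let $f\colon\mathbb{R}^n\times\mathbb{R}^m\to\mathbb{R}^n$ satisfy $f(0,0)=0$ and be of class $C^1$ in a neighborhood of $(0,0)$, and put $A:=\nabla_x f(0,0)$. Assume that $$\{\lambda\in\Lambda(A) : \mathrm{Re}(\lambda)\ge 0\}=\{\lambda\in\Lambda(A) : \mathrm{Re}(\lambda)>0\},$$ where $\Lambda(A)\subset\mathbb{C}$ is the set of eigenvalues of $A$. If the control system $\dot x=f(x,u)$ can be locally asymptotically stabilized by means of continuously differentiable stationary feedback laws, then $f$ is linearly open around $(0,0)$.
   Context: $\mathbb{B}_r(z)$ is the closed ball of radius $r>0$ centered at $z$ (Euclidean norm); $\mathbb{R}^n\times\mathbb{R}^m$ is identified with $\mathbb{R}^{n+m}$. Linear openness: a mapping $f\colon\mathbb{R}^l\to\mathbb{R}^n$ is linearly open around $\bar z$ if there are $\kappa>0$ and a neighborhood $U$ of $\bar z$ such that $\mathbb{B}_{\kappa r}(f(z))\subset f(\mathbb{B}_r(z))$ for all $z\in U$ and $r>0$ with $\mathbb{B}_r(z)\subset U$. Local asymptotic stabilization by means of continuously differentiable stationary feedback laws: there exists a $C^1$ map $u\colon\mathbb{R}^n\to\mathbb{R}^m$ with $u(0)=0$ such that $0\in\mathbb{R}^n$ is a locally asymptotically stable equilibrium point (Lyapunov stable and locally attractive) of the closed-loop system $\dot x=f(x,u(x))$. *)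

(* Defs.v *)
From mathcomp Require Import all_boot all_order all_algebra.
From mathcomp Require Import all_classical all_reals all_analysis.
From mathcomp Require Import complex.

Set Implicit Arguments.
Unset Strict Implicit.
Unset Printing Implicit Defensive.

Import Order.TTheory GRing.Theory Num.Theory.
Import numFieldNormedType.Exports.

Local Open Scope classical_set_scope.
Local Open Scope ring_scope.

(* Points of R^n are row vectors, and R^n x R^m is 'rV[R]_(n + m), the pair
   (x, u) being row_mx x u.  The norm `|_| of the library on 'rV[R]_n is the
   sup norm; it only enters through the topology, while balls are Euclidean. *)

Definition enorm (R : realType) (n : nat) (v : 'rV[R]_n) : R :=
  Num.sqrt (\sum_(i < n) v ord0 i ^+ 2).

Definition eball (R : realType) (n : nat) (z : 'rV[R]_n) (r : R) :
    set 'rV[R]_n :=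
  [set y | enorm (y - z) <= r].

Definition linearly_open_around (R : realType) (l n : nat)
    (f : 'rV[R]_l -> 'rV[R]_n) (zbar : 'rV[R]_l) : Prop :=
  exists (kappa : R) (U : set 'rV[R]_l),
    [/\ 0 < kappa, nbhs zbar U &
        forall (z : 'rV[R]_l) (r : R), U z -> 0 < r -> eball z r `<=` U ->
          eball (f z) (kappa * r) `<=` f @` eball z r].

(* Meant for open U. *)
Definition C1_on (R : realType) (l n : nat) (U : set 'rV[R]_l)
    (f : 'rV[R]_l -> 'rV[R]_n) : Prop :=
  forall z, U z -> differentiable f z /\ {for z, continuous (jacobian f)}.

(* The library's Jacobian acts on row vectors, df(v) = v *m jacobian f p, and
   its eigenvalues are those of v |-> v *m J; so this is the transpose of the
   usual matrix, and the eigenvalues below are the usual ones. *)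
Definition partial_x (R : realType) (n m : nat)
    (f : 'rV[R]_(n + m) -> 'rV[R]_n) (x : 'rV[R]_n) (u : 'rV[R]_m) : 'M[R]_n :=
  jacobian (fun y : 'rV[R]_n => f (row_mx y u)) x.

Definition spectrum (R : realType) (n : nat) (A : 'M[R]_n) : set R[i] :=
  [set lambda | eigenvalue (map_mx (real_complex R) A) lambda].

Definition is_solution (R : realType) (n : nat) (F : 'rV[R]_n -> 'rV[R]_n)
    (I : interval R) (x : R -> 'rV[R]_n) : Prop :=
  {within [set` I], continuous x} /\
  forall t : R, interior [set` I] t -> is_derive t (1 : R) x (F (x t)).

(* In the next two definitions existence of solutions is not demanded: when F
   is C^1 near xe, Lyapunov stability forces the solutions starting close to xe
   to exist on [0, +oo[. *)
Definition lyapunov_stable (R : realType) (n : nat)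
    (F : 'rV[R]_n -> 'rV[R]_n) (xe : 'rV[R]_n) : Prop :=
  forall eps : R, 0 < eps -> exists2 delta : R, 0 < delta &
    forall (T : R) (x : R -> 'rV[R]_n),
      0 <= T -> is_solution F `[0, T] x -> enorm (x 0 - xe) < delta ->
      forall t : R, 0 <= t <= T -> enorm (x t - xe) < eps.

Definition locally_attractive (R : realType) (n : nat)
    (F : 'rV[R]_n -> 'rV[R]_n) (xe : 'rV[R]_n) : Prop :=
  exists2 delta : R, 0 < delta &
    forall x : R -> 'rV[R]_n,
      is_solution F `[0, +oo[ x -> enorm (x 0 - xe) < delta ->
      x t @[t --> +oo%R] --> xe.

Definition locally_asymptotically_stable (R : realType) (n : nat)
    (F : 'rV[R]_n -> 'rV[R]_n) (xe : 'rV[R]_n) : Prop :=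
  [/\ F xe = 0, lyapunov_stable F xe & locally_attractive F xe].

Definition C1_feedback_stabilizable (R : realType) (n m : nat)
    (f : 'rV[R]_(n + m) -> 'rV[R]_n) : Prop :=
  exists u : 'rV[R]_n -> 'rV[R]_m,
    [/\ C1_on setT u, u 0 = 0 &
        locally_asymptotically_stable (fun x => f (row_mx x (u x))) 0].

(* Main.v *)
Require Import Defs.
From HB Require Import structures.
From mathcomp Require Import all_boot all_order all_algebra.
From mathcomp Require Import all_classical all_reals all_analysis.
From mathcomp Require Import complex ring lra.

(** The set of eigenvalues with nonnegative real part equals the set of those
    with positive real part exactly when no eigenvalue of A lies on the
    imaginary axis.  In particular 0 is not an eigenvalue, so A, the partial
    derivative of f in x at (0, 0), is invertible ([unitmx_of_spectrumN0]), and
    df(0, 0) is onto already in the x direction.  Linear openness is then the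
    Lyusternik-Graves theorem in the case where the derivative is inverted
    along x ([linearly_open_partial_x_unit]).

    To reach a target w near f(x, u), u is kept and y is sought near x as a
    fixed point of the quasi-Newton map y |-> y + (w - f(y, u)) A^-1, in row
    vector notation.  Its Lipschitz constant is governed by how far f is, on
    pairs of points near (0, 0), from its linear part at (0, 0); since f is C^1
    this deviation is at most eps |p - q| on a small ball
    ([C1_strictly_differentiable], from the mean value theorem taken
    coordinate by coordinate).  The radius of that ball, hence the neighborhood
    on which openness holds, and the rate kappa are independent of the
    base point and of r.

    All estimates are made in the sup norm.  The passage to Euclidean balls
    costs the factor n of [ler_enorm_norm], which goes into kappa. *)

Set Implicit Arguments.
Unset Strict Implicit.
Unset Printing Implicit Defensive.

Import Order.TTheory GRing.Theory Num.Theory.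
Import numFieldNormedType.Exports.

Local Open Scope classical_set_scope.
Local Open Scope ring_scope.

(** Completeness and the norm on matrices are separate structures; declaring
    completeness again joins them, so that Banach's fixed point theorem
    applies to row vectors. *)
HB.instance Definition _ (R : realType) (m n : nat) :=
  Uniform_isComplete.Build 'M[R]_(m, n) (@mx_complete R m n).

Lemma ler_norm_entry (R : realType) (m n : nat) (M : 'M[R]_(m, n)) i j :
  `|M i j| <= `|M|.
Proof.
rewrite [leRHS]/Num.Def.normr /= mx_normrE.
exact: (le_bigmax _ (fun ij => `|M ij.1 ij.2|) (i, j)).
Qed.

Lemma ler_norm_mx (R : realType) (m n : nat) (M : 'M[R]_(m, n)) c :
  0 <= c -> (forall i j, `|M i j| <= c) -> `|M| <= c.
Proof.
move=> c0 Mc; rewrite /Num.Def.normr /= mx_normrE.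
by apply: bigmax_le => // i _; exact: Mc.
Qed.

Lemma ler_norm_mulmx (R : realType) (l n : nat) (v : 'rV[R]_l)
    (M : 'M[R]_(l, n)) : `|v *m M| <= l%:R * (`|v| * `|M|).
Proof.
apply: ler_norm_mx => [|i j]; first by rewrite !mulr_ge0.
rewrite mxE (le_trans (ler_norm_sum _ _ _))//.
have -> : l%:R = \sum_(k < l) 1 :> R by rewrite sumr_const card_ord.
rewrite mulr_suml.
apply: ler_sum => k _; rewrite mul1r normrM.
by apply: ler_pM => //; exact: ler_norm_entry.
Qed.

Lemma ler_norm_enorm (R : realType) (n : nat) (v : 'rV[R]_n) :
  `|v| <= enorm v.
Proof.
apply: ler_norm_mx => [|i j]; first exact: sqrtr_ge0.
rewrite ord1 -sqrtr_sqr ler_wsqrtr// (bigD1 j)//= lerDl.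
by apply: sumr_ge0 => k _; exact: sqr_ge0.
Qed.

Lemma ler_enorm_norm (R : realType) (n : nat) (v : 'rV[R]_n) :
  enorm v <= n%:R * `|v|.
Proof.
rewrite -[leRHS]ger0_norm ?mulr_ge0// -sqrtr_sqr ler_wsqrtr//.
apply: (@le_trans _ _ (n%:R * `|v| ^+ 2)).
  have -> : n%:R = \sum_(k < n) 1 :> R by rewrite sumr_const card_ord.
  rewrite mulr_suml.
  apply: ler_sum => k _; rewrite mul1r -real_normK ?num_real//.
  by rewrite lerXn2r ?nnegrE//; exact: ler_norm_entry.
rewrite exprMn ler_wpM2r ?sqr_ge0// expr2 -natrM ler_nat.
by case: n v => // n v; rewrite leq_pmulr.
Qed.

Lemma enorm_row_mx0 (R : realType) (n m : nat) (v : 'rV[R]_n) :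
  enorm (row_mx v (0 : 'rV[R]_m)) = enorm v.
Proof.
rewrite /enorm big_split_ord /= [X in _ + X]big1 => [|i _].
  by rewrite addr0; under eq_bigr do rewrite row_mxEl.
by rewrite row_mxEr mxE expr0n.
Qed.

(** Both difference quotients are the same function of the increment. *)
Lemma is_derive_line (R : realType) (V W : normedModType R) (g : V -> W)
    (q v : V) (t : R) :
  derivable g (q + t *: v) v ->
  is_derive t 1 (fun s : R => g (q + s *: v)) ('D_v g (q + t *: v)).
Proof.
move=> gv.
have E : (fun h : R => h^-1 *: (g (q + (h *: 1 + t) *: v) - g (q + t *: v))) =
         (fun h : R => h^-1 *: (g (h *: v + (q + t *: v)) - g (q + t *: v))).
  by apply/funext => h; rewrite [h *: 1]mulr1 scalerDl addrCA.
by apply: DeriveDef; rewrite /derivable /derive /= E.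
Qed.

(** The mean value theorem fails for vector-valued maps, but each coordinate
    has its own intermediate point, and in the sup norm the coordinates can be
    bounded one at a time.  The factor l comes from bounding a product of a row
    vector with a matrix by entrywise norms. *)
Lemma mean_value_bound (R : realType) (l n : nat) (f : 'rV[R]_l -> 'rV[R]_n)
    (p q : 'rV[R]_l) (J : 'M[R]_(l, n)) (c : R) :
  (forall t : R, 0 <= t <= 1 -> differentiable f (q + t *: (p - q)) /\
     `|jacobian f (q + t *: (p - q)) - J| <= c) ->
  `|f p - f q - (p - q) *m J| <= l%:R * (`|p - q| * c).
Proof.
move=> fJ; have c0 : 0 <= c.
  by apply: le_trans (fJ 0 _).2; rewrite ?lexx ?ler01.
apply: ler_norm_mx => [|i j]; first by rewrite !mulr_ge0.
rewrite {i}ord1; set v : 'rV[R]_l := p - q in fJ *.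
pose h (t : R) : R := f (q + t *: v) ord0 j.
have dh (t : R) : 0 <= t <= 1 ->
    is_derive t (1 : R) h ((v *m jacobian f (q + t *: v)) ord0 j).
  move=> /fJ[df _].
  have dfv : derivable f (q + t *: v) v by exact: diff_derivable.
  rewrite -deriveEjacobian// derive_mx// mxE.
  exact: is_derive_line ((derivable_mxP _ _ _).1 dfv ord0 j).
have [||s s01] := @MVT_segment R h
    (fun t => (v *m jacobian f (q + t *: v)) ord0 j) 0 1 ler01.
- by move=> t /[!in_itv]/= /andP[/ltW ? /ltW ?]; apply: dh; apply/andP.
- apply: derivable_within_continuous => t /[!in_itv]/= /dh ?.
  exact: ex_derive.
rewrite subr0 mulr1 /h scale1r scale0r addr0 [q + v]addrC subrK => E.
move: s01; rewrite in_itv/= => /fJ[_ Jc].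
have -> : (f p - f q - v *m J) ord0 j =
          (v *m (jacobian f (q + s *: v) - J)) ord0 j.
  by rewrite mulmxBr !mxE -/v; rewrite mxE in E; rewrite E.
rewrite (le_trans (ler_norm_entry _ _ _))// (le_trans (ler_norm_mulmx _ _))//.
by rewrite !ler_wpM2l.
Qed.

(** Near z the Jacobian is within a small constant of its value at z, and this
    persists along the segment from q to p because balls are convex. *)
Lemma C1_strictly_differentiable (R : realType) (l n : nat)
    (f : 'rV[R]_l -> 'rV[R]_n) (U : set 'rV[R]_l) (z : 'rV[R]_l) (eps : R) :
  open_nbhs z U -> C1_on U f -> 0 < eps ->
  exists2 rho : R, 0 < rho & forall p q, `|p - z| < rho -> `|q - z| < rho ->
    `|f p - f q - (p - q) *m jacobian f z| <= eps * `|p - q|.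
Proof.
move=> zU fC1 eps0; have [_ Uz] := zU.
(* The divisor absorbs the factor l of [mean_value_bound]; l.+1 covers l = 0. *)
have e0 : 0 < eps / l.+1%:R by rewrite divr_gt0.
have : \forall w \near z,
    differentiable f w /\ `|jacobian f w - jacobian f z| <= eps / l.+1%:R.
  near=> w; split.
    have Uw : U w by near: w; exact: open_nbhs_nbhs.
    by have [] := fC1 w Uw.
  rewrite distrC; near: w.
  have [_ cJ] := fC1 z Uz.
  by move/cvgrPdist_le : cJ; exact.
move=> /nbhs_normP[rho /= rho0 rhoP]; exists rho => // p q pz qz.
have segP (t : R) : 0 <= t <= 1 -> `|(q + t *: (p - q)) - z| < rho.
  move=> /andP[t0 t1].
  (* A convex combination of p - z and q - z. *)
  have -> : q + t *: (p - q) - z = t *: (p - z) + (1 - t) *: (q - z).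
    rewrite !scalerBr !scalerBl !scale1r.
    by apply/matrixP => i j; rewrite !mxE; ring.
  rewrite (le_lt_trans (ler_normD _ _))// !normrZ.
  rewrite ger0_norm// ger0_norm ?subr_ge0//.
  have [->|tn0] := eqVneq t 0; first by rewrite mul0r add0r subr0 mul1r.
  have t_gt0 : 0 < t by rewrite lt_def tn0.
  have : t * `|p - z| < t * rho by rewrite ltr_pM2l.
  have : (1 - t) * `|q - z| <= (1 - t) * rho.
    by rewrite ler_wpM2l ?subr_ge0// ltW.
  lra.
have H := @mean_value_bound R l n f p q (jacobian f z) (eps / l.+1%:R).
apply: le_trans (H _) _ => [t t01|].
  by apply: rhoP; rewrite /ball_/= distrC; exact: segP.
rewrite mulrCA [leRHS]mulrC ler_wpM2l// mulrCA ler_piMr//; first exact: ltW.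
by rewrite ler_pdivrMr// mul1r ler_nat.
Unshelve. all: by end_near. Qed.

Lemma continuous_mulmxr (R : realType) (l n : nat) (M : 'M[R]_(l, n)) :
  continuous (fun v : 'rV[R]_l => v *m M).
Proof.
apply: (linear_bounded_continuous (mulmxr M)).1.
rewrite /bounded_near; near=> C; rewrite /=; near=> v => /=.
apply: le_trans (ler_norm_mulmx v M) _.
apply: (@le_trans _ _ (l%:R * (1 * `|M|))); last first.
  by near: C; exact: nbhs_pinfty_ge.
by rewrite ler_wpM2l// ler_wpM2r//; near: v; exact: nbhs0_le.
Unshelve. all: by end_near. Qed.

Lemma differentiable_row_mx_left (R : realType) (n m : nat) (x : 'rV[R]_n)
    (u : 'rV[R]_m) : differentiable (fun y : 'rV[R]_n => row_mx y u) x.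
Proof.
have -> : (fun y : 'rV[R]_n => row_mx y u) =
    (fun y => y *m row_mx 1%:M 0) + cst (row_mx 0 u).
  apply/funext => y.
  by rewrite /= fctE mul_mx_row mulmx1 mulmx0 add_row_mx addr0 add0r.
apply: differentiableD => //.
exact: (@linear_differentiable _ _ _ (mulmxr (row_mx 1%:M 0)) x
  (@continuous_mulmxr R _ _ (row_mx 1%:M 0))).
Qed.

(** The difference quotients of the partial map at x along v are those of f
    along (v, 0). *)
Lemma mulmx_partial_x (R : realType) (n m : nat)
    (f : 'rV[R]_(n + m) -> 'rV[R]_n) (x v : 'rV[R]_n) (u : 'rV[R]_m) :
  differentiable f (row_mx x u) ->
  v *m partial_x f x u = row_mx v 0 *m jacobian f (row_mx x u).
Proof.
move=> df; rewrite /partial_x -deriveEjacobian; last first.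
  exact: (differentiable_comp (differentiable_row_mx_left x u) df).
rewrite -deriveEjacobian// /derive.
suff -> : (fun h : R => h^-1 *:
              (f (row_mx (h *: v + x) u) - f (row_mx x u))) =
          (fun h => h^-1 *:
              (f (h *: row_mx v 0 + row_mx x u) - f (row_mx x u))).
  by [].
by apply/funext => h; rewrite scale_row_mx scaler0 add_row_mx add0r.
Qed.

Lemma ler_norm_row_mx0 (R : realType) (n m : nat) (v : 'rV[R]_n) :
  `|row_mx v (0 : 'rV[R]_m)| <= `|v|.
Proof.
apply: ler_norm_mx => // i j; rewrite mxE.
by case: splitP => k _; rewrite ?mxE ?normr0// ler_norm_entry.
Qed.

(** The set on which the fixed point is sought is the sup ball of radius
    r / n.+1 around x: it lies inside the Euclidean ball of radius r, and it
    is mapped into itself because half of its radius is used by the contraction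
    and the other half by the first step Phi x - x. *)
Lemma linearly_open_partial_x_unit (R : realType) (n m : nat)
    (f : 'rV[R]_(n + m) -> 'rV[R]_n) (U : set 'rV[R]_(n + m))
    (x0 : 'rV[R]_n) (u0 : 'rV[R]_m) :
  open_nbhs (row_mx x0 u0) U -> C1_on U f ->
  partial_x f x0 u0 \in unitmx -> linearly_open_around f (row_mx x0 u0).
Proof.
move=> zU fC1; set A := partial_x f x0 u0 => Aunit.
have df0 : differentiable f (row_mx x0 u0) by have [] := fC1 _ zU.2.
pose K : R := n%:R * `|invmx A|.
have K0 : 0 <= K by rewrite mulr_ge0.
(* Chosen so that n * |A^-1| * eps <= 1/2, the contraction factor. *)
pose eps : R := (2 * K + 1)^-1.
have eps0 : 0 < eps by rewrite invr_gt0; lra.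
have Keps : K * eps <= 2^-1.
  by rewrite ler_pdivrMr; lra.
have [rho rho0 rhoP] := C1_strictly_differentiable zU fC1 eps0.
pose N : R := n.+1%:R.
have N0 : 0 < N by rewrite ltr0n.
(* Chosen so that the first step has length at most (r / N) / 2. *)
pose kappa : R := (2 * N * (K + 1))^-1.
have kappa0 : 0 < kappa by rewrite invr_gt0 !mulr_gt0//; lra.
have Kkappa : K * kappa <= 2^-1 / N.
  rewrite /kappa invfM mulrCA invfM ler_piMr//.
    by rewrite ltW// divr_gt0.
  by rewrite ler_pdivrMr; lra.
exists kappa, (ball (row_mx x0 u0) rho); split => //; first exact: nbhsx_ballx.
move=> z r _ r0 zr w; rewrite /eball/= => wz.
set x := lsubmx z; set u := rsubmx z.
have zE : z = row_mx x u by rewrite hsubmxK.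
pose Phi (y : 'rV[R]_n) : 'rV[R]_n := y + (w - f (row_mx y u)) *m invmx A.
pose B : set 'rV[R]_n := closed_ball_ Num.norm x (r / N).
have Bz (y : 'rV[R]_n) : B y -> eball z r (row_mx y u).
  rewrite /B/closed_ball_/eball/= distrC => yx.
  rewrite zE opp_row_mx add_row_mx subrr enorm_row_mx0.
  rewrite (le_trans (ler_enorm_norm _))//.
  apply: (@le_trans _ _ (N * (r / N))); last by rewrite mulrC divfK ?gt_eqF.
  by rewrite ler_pM// ler_nat.
have BN (y : 'rV[R]_n) : B y -> `|row_mx y u - row_mx x0 u0| < rho.
  by move=> /Bz/zr; rewrite -ball_normE /= distrC.
have contr (y y' : 'rV[R]_n) : B y -> B y' ->
    `|Phi y - Phi y'| <= 2^-1 * `|y - y'|.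
  move=> By By'.
  have -> : Phi y - Phi y' = - ((f (row_mx y u) - f (row_mx y' u)
      - (row_mx y u - row_mx y' u) *m jacobian f (row_mx x0 u0)) *m invmx A).
    rewrite opp_row_mx add_row_mx subrr -mulmx_partial_x//.
    rewrite [in RHS]mulmxBl mulmxK// /Phi -/A !mulmxBl.
    by apply/matrixP => i j; rewrite !mxE; ring.
  rewrite normrN (le_trans (ler_norm_mulmx _ _))//.
  rewrite [X in _ * X]mulrC mulrA -/K.
  apply: (@le_trans _ _ (K * (eps * `|y - y'|))); last first.
    by rewrite mulrA ler_wpM2r.
  rewrite ler_wpM2l// (le_trans (rhoP _ _ (BN _ By) (BN _ By')))//.
  rewrite ler_wpM2l ?(ltW eps0)// opp_row_mx add_row_mx subrr.
  exact: ler_norm_row_mx0.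
have rN0 : 0 <= r / N by rewrite divr_ge0// ltW.
have Bx : B x by rewrite /B/closed_ball_/= subrr normr0.
have PhiB : set_fun B B Phi.
  move=> y By; rewrite /B/closed_ball_/= distrC.
  rewrite -(subrKA (Phi x)) (le_trans (ler_normD _ _))//.
  have H1 : `|Phi y - Phi x| <= 2^-1 * (r / N).
    rewrite (le_trans (contr _ _ By Bx))// ler_wpM2l//.
    by move: By; rewrite /B/closed_ball_/= distrC.
  have H2 : `|Phi x - x| <= 2^-1 * (r / N).
    rewrite /Phi addrC addKr -zE (le_trans (ler_norm_mulmx _ _))//.
    rewrite [X in _ * X]mulrC mulrA -/K.
    apply: (@le_trans _ _ (K * (kappa * r))).
      by rewrite ler_wpM2l// (le_trans (ler_norm_enorm _)).
    by rewrite mulrA [r / N]mulrC mulrA ler_wpM2r// ltW.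
  by rewrite [leRHS]splitr [r / N / 2]mulrC lerD.
have Phi_contr : is_contraction (mkfun_fun PhiB).
  exists (2^-1)%:nng; split => /=; first by rewrite invf_lt1// ltr1n.
  by move=> -[y y'] /= [By By']; exact: contr.
have [y By yE] := banach_fixed_point Phi_contr (@closed_closed_ball_ _ _ _ _)
  (ex_intro _ x Bx).
exists (row_mx y u); first exact: Bz.
have : (w - f (row_mx y u)) *m invmx A = 0.
  by apply: (addrI y); rewrite addr0; exact: esym yE.
move/(congr1 (mulmx^~ A)); rewrite mulmxKV// mul0mx.
by move/eqP; rewrite subr_eq0 => /eqP.
Qed.

Lemma unitmx_of_spectrumN0 (R : realType) (n : nat) (A : 'M[R]_n) :
  ~ spectrum A 0 -> A \in unitmx.
Proof.
move=> A0; rewrite -(map_unitmx (real_complex R)); apply: contra_notT A0.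
rewrite -row_free_unit -kermx_eq0 => /rowV0Pn[v /sub_kermxP vA v0].
by apply/eigenvalueP; exists v => //; rewrite scale0r.
Qed.

Theorem theorem3p16 (R : realType) (n m : nat)
    (f : 'rV[R]_(n + m) -> 'rV[R]_n)
    (f0 : f 0 = 0)
    (fC1 : exists2 U : set 'rV[R]_(n + m), open_nbhs (0 : 'rV[R]_(n + m)) U & C1_on U f)
    (HA : [set lambda | spectrum (partial_x f 0 0) lambda /\
                        0 <= complex.Re lambda] =
          [set lambda | spectrum (partial_x f 0 0) lambda /\
                        0 < complex.Re lambda])
    (Hstab : C1_feedback_stabilizable f) :
  linearly_open_around f 0.
Proof.
have [U zU UC1] := fC1.
rewrite -(row_mx0 R 1 n m) in zU *.
apply: (linearly_open_partial_x_unit zU UC1); apply: unitmx_of_spectrumN0 => A0.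
have : [set lambda | spectrum (partial_x f 0 0) lambda /\
                     0 <= complex.Re lambda] 0 by split.
by rewrite HA => -[_ /=]; rewrite ltxx.
Qed.
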